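(* Let $U$ be a finite universe, let $f: 2^{U} \to \mathbb{R}^{+}$ be a monotone supermodular set function with $f(\emptyset)=0$, given by a value oracle, and let $\mathcal{M}=(U,\mathcal{I})$ be a matroid on $U$, given by an independence oracle. Consider the problem of maximizing the density $d(S)=f(S)/|S|$ over nonempty sets $S\subseteq U$ that are feasible, where $S$ is feasible iff its complement $U\setminus S$ is independent in $\mathcal{M}$. There is a polynomial-time $2$-approximation algorithm for this problem, i.e. an algorithm that outputs a feasible set $S$ with $d(S)\geq \tfrac12 \max\{d(T): T \text{ feasible}\}$.
   Context: A set function $f$ on $U$ is monotone if $f(A)\le f(B)$ whenever $A\subseteq B$, and supermodular if $f(A)+f(B)\le f(A\cup B)+f(A\cap B)$ for all $A,B\subseteq U$. A matroid $\mathcal{M}=(U,\mathcal{I})$ is a family $\mathcal{I}\subseteq 2^U$ of independent sets that is closed under taking subsets and satisfies the extension property: if $A,B\in\mathcal{I}$ and $|A|<|B|$ then there is $x\in B\setminus A$ with $A\cup\{x\}\in\mathcal{I}$. *)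

(* Defs.v *)
From HB Require Import structures.
From mathcomp Require Import all_boot all_order all_algebra.
From mathcomp Require Import reals.

Set Implicit Arguments.
Unset Strict Implicit.
Unset Printing Implicit Defensive.

Import Order.TTheory GRing.Theory Num.Theory.
Local Open Scope ring_scope.

Definition monotone (R : realType) (U : finType) (f : {set U} -> R) : Prop :=
  forall A B : {set U}, A \subset B -> f A <= f B.

Definition supermodular (R : realType) (U : finType) (f : {set U} -> R) : Prop :=
  forall A B : {set U}, f A + f B <= f (A :|: B) + f (A :&: B).

(* The empty family is allowed; it makes no set feasible. *)
Definition matroid (U : finType) (I : {set {set U}}) : Prop :=
  (forall A B : {set U}, A \subset B -> B \in I -> A \in I) /\
  (forall A B : {set U}, A \in I -> B \in I -> (#|A| < #|B|)%N ->
     exists2 x, x \in B :\: A & x |: A \in I).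

Definition feasible (U : finType) (I : {set {set U}}) (S : {set U}) : bool :=
  ~: S \in I.

Definition density (R : realType) (U : finType) (f : {set U} -> R)
    (S : {set U}) : R := f S / #|S|%:R.

(* Algorithms are programs for a unit-cost real RAM with oracles.  The syntax
   mentions neither the universe nor the oracles nor any real constant but 0
   and 1, so one program is a uniform algorithm for all instances.  The memory
   holds naturals and reals in arrays with two indices, [a[i, j]], all cells
   being initially 0.  There is no multiplication of naturals (in t steps
   naturals stay below 2^O(t)) and no rounding from reals to naturals: with
   either of these, unit cost would not be a reasonable measure of time. *)

Inductive iexp : Type :=
  | ICard                                   (* the size of the universe *)
  | IConst of nat
  | IGet of nat & iexp & iexp               (* [IGet a i j] is [a[i, j]] *)
  | IAdd of iexp & iexp
  | ISub of iexp & iexp.                    (* truncated *)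

Inductive rexp : Type :=
  | RZero
  | ROne
  | RGet of nat & iexp & iexp
  | RAdd of rexp & rexp
  | ROpp of rexp
  | RMul of rexp & rexp
  | RInv of rexp.

Inductive bexp : Type :=
  | BLeI of iexp & iexp
  | BLeR of rexp & rexp
  | BNot of bexp
  | BAnd of bexp & bexp.

(* [CValue a i j b k] stores in the real cell [a[i, j]] the value of the set
   coded by row [k] of the natural array [b]; [CIndep] stores in a natural cell
   the answer (0 or 1) of the independence oracle for such a set. *)
Inductive cmd : Type :=
  | CSkip
  | CSetI of nat & iexp & iexp & iexp       (* [CSetI a i j e]: a[i, j] := e *)
  | CSetR of nat & iexp & iexp & rexp
  | CValue of nat & iexp & iexp & nat & iexp
  | CIndep of nat & iexp & iexp & nat & iexp
  | CSeq of cmd & cmd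
  | CIf of bexp & cmd & cmd
  | CWhile of bexp & cmd.

Definition memory (T : Type) : Type := nat -> nat -> nat -> T.

Definition upd (T : Type) (m : memory T) (a i j : nat) (v : T) : memory T :=
  fun a' i' j' => if [&& a' == a, i' == i & j' == j] then v else m a' i' j'.

Record state (R : realType) : Type :=
  State { imem : memory nat; rmem : memory R }.

Definition init_state (R : realType) : state R :=
  State (fun _ _ _ => 0%N) (fun _ _ _ => 0).

Fixpoint ieval (n : nat) (m : memory nat) (e : iexp) : nat :=
  match e with
  | ICard => n
  | IConst k => k
  | IGet a i j => m a (ieval n m i) (ieval n m j)
  | IAdd e1 e2 => (ieval n m e1 + ieval n m e2)%N
  | ISub e1 e2 => (ieval n m e1 - ieval n m e2)%N
  end.

Fixpoint reval (R : realType) (n : nat) (s : state R) (e : rexp) : R :=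
  match e with
  | RZero => 0
  | ROne => 1
  | RGet a i j => rmem s a (ieval n (imem s) i) (ieval n (imem s) j)
  | RAdd e1 e2 => reval n s e1 + reval n s e2
  | ROpp e1 => - reval n s e1
  | RMul e1 e2 => reval n s e1 * reval n s e2
  | RInv e1 => (reval n s e1)^-1
  end.

Fixpoint beval (R : realType) (n : nat) (s : state R) (b : bexp) : bool :=
  match b with
  | BLeI e1 e2 => (ieval n (imem s) e1 <= ieval n (imem s) e2)%N
  | BLeR e1 e2 => reval n s e1 <= reval n s e2
  | BNot b1 => ~~ beval n s b1
  | BAnd b1 b2 => beval n s b1 && beval n s b2
  end.

(* The elements of the universe are numbered by [enum_rank]; row [i] of array
   [a] codes a set by its characteristic vector. *)
Definition coded_set (U : finType) (m : memory nat) (a i : nat) : {set U} :=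
  [set u : U | m a i (enum_rank u) != 0%N].

(* [exec f I c s t s']: with value oracle [f] and independence oracle [I], the
   command [c] started in [s] halts in [s'] after [t] steps.  Expressions are
   evaluated in one step since a program contains finitely many of them. *)
Inductive exec (R : realType) (U : finType) (f : {set U} -> R)
    (I : {set {set U}}) : cmd -> state R -> nat -> state R -> Prop :=
  | ExecSkip s : exec f I CSkip s 1 s
  | ExecSetI a i j e s :
      let ev := ieval #|U| (imem s) in
      exec f I (CSetI a i j e) s 1
        (State (upd (imem s) a (ev i) (ev j) (ev e)) (rmem s))
  | ExecSetR a i j e s :
      let ev := ieval #|U| (imem s) in
      exec f I (CSetR a i j e) s 1
        (State (imem s) (upd (rmem s) a (ev i) (ev j) (reval #|U| s e)))
  | ExecValue a i j b k s :
      let ev := ieval #|U| (imem s) in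
      exec f I (CValue a i j b k) s 1
        (State (imem s)
           (upd (rmem s) a (ev i) (ev j) (f (coded_set U (imem s) b (ev k)))))
  | ExecIndep a i j b k s :
      let ev := ieval #|U| (imem s) in
      exec f I (CIndep a i j b k) s 1
        (State (upd (imem s) a (ev i) (ev j)
                  (coded_set U (imem s) b (ev k) \in I : nat))
           (rmem s))
  | ExecSeq c1 c2 s t1 s1 t2 s2 :
      exec f I c1 s t1 s1 -> exec f I c2 s1 t2 s2 ->
      exec f I (CSeq c1 c2) s (t1 + t2)%N s2
  | ExecIf b c1 c2 s t s' :
      exec f I (if beval #|U| s b then c1 else c2) s t s' ->
      exec f I (CIf b c1 c2) s t.+1 s'
  | ExecWhileStop b c s :
      ~~ beval #|U| s b -> exec f I (CWhile b c) s 1 s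
  | ExecWhileLoop b c s t1 s1 t2 s2 :
      beval #|U| s b -> exec f I c s t1 s1 ->
      exec f I (CWhile b c) s1 t2 s2 ->
      exec f I (CWhile b c) s (t1 + t2).+1 s2.

Lemma exec_det (R : realType) (U : finType) (f : {set U} -> R)
    (I : {set {set U}}) c s t s1 t' s2 :
  exec f I c s t s1 -> exec f I c s t' s2 -> t = t' /\ s1 = s2.
Proof.
move=> H; elim: H t' s2 => {c s t s1}.
1-5: by intros; match goal with H : exec _ _ _ _ _ _ |- _ => inversion H end.
- move=> c1 c2 s t1 s1 t2 s2 _ IH1 _ IH2 t' s' H.
  inversion H as [| | | | |? ? ? ? ? ? ? E1 E2| | |]; subst.
  by have [-> ?] := IH1 _ _ E1; subst; have [-> ->] := IH2 _ _ E2.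
- move=> b c1 c2 s t s' _ IH t' s2 H.
  inversion H as [| | | | | |? ? ? ? ? ? E| |]; subst.
  by have [-> ->] := IH _ _ E.
- move=> b c s nb t' s2 H.
  inversion H as [| | | | | | | |? ? ? ? ? ? ? hb]; subst => //.
  by rewrite hb in nb.
- move=> b c s t1 s1 t2 s2 hb _ IH1 _ IH2 t' s' H.
  inversion H as [| | | | | | |? ? ? nb|? ? ? ? ? ? ? ? E1 E2]; subst.
    by rewrite hb in nb.
  by have [-> ?] := IH1 _ _ E1; subst; have [-> ->] := IH2 _ _ E2.
Qed.

(* The output is the set coded by row 0 of the natural array 0 on halting. *)
Definition outputs (R : realType) (U : finType) (f : {set U} -> R)
    (I : {set {set U}}) (P : cmd) (t : nat) (S : {set U}) : Prop :=
  exists2 s, exec f I P (init_state R) t s & S = coded_set U (imem s) 0 0.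

(* Main.v *)
Require Import Defs.
From HB Require Import structures.
From mathcomp Require Import all_boot all_order all_algebra.
From mathcomp Require Import boolp reals.
From mathcomp Require Import ring lra zify.

Set Implicit Arguments.
Unset Strict Implicit.
Unset Printing Implicit Defensive.

Import Order.TTheory GRing.Theory Num.Theory.
Local Open Scope ring_scope.

(* The Frank-Wolfe method is run on the squared norm over the polyhedron of the
   weights [b >= 0] with [f S <= b(S)] for all [S].  Each step sorts [U] by
   decreasing weight and moves towards the greedy vertex, whose coordinates are
   the marginal values of [f] along the order.  Every proper prefix [S] of
   every order met is a candidate: the complement of [S] is shrunk greedily to
   a maximal independent set [A], and as [A] is at least as large as the
   complement of [S :|: T] for any feasible [T], the completion [~: A] has
   density at least [f S / #|S :|: T|].

   Put [lam := density f T / 2].  If the density of the whole universe is below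
   [lam] and so are all these quotients, then every prefix [S] is worse by
   [lam / 2] than the maximum of [f W - lam * #|W|]: either [S] meets [T] and
   [W := T] beats it, or [S] is disjoint from [T] and [W := S :|: T] does.
   On the other hand [b(W) - lam * #|W|] is nearly maximal at the prefixes cut
   at a weight in [[lam, lam + w]] with [w := lam / (4 n)], so [b(S) - f S] is
   at least [lam / 4] there.  Summation by parts makes the Frank-Wolfe gap at
   least [w * lam / 4], and a step of fixed size decreases the squared norm by
   [lam^2 / (256 n^5)].  The norm starts below [n^3 lam^2], so [256 n^8] steps
   cannot all fail. *)

(** * The greedy vertex of an order *)

Section TotalOrder.
Variables (R : realType) (U : finType) (le : rel U).
Hypotheses (le_refl : reflexive le) (le_trans : transitive le).
Hypotheses (le_total : total le) (le_anti : antisymmetric le).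

Definition downset (v : U) : {set U} := [set u | le u v].

Lemma set_max (A : {set U}) :
  A != set0 -> exists2 v, v \in A & forall u, u \in A -> le u v.
Proof.
case/set0Pn=> a aA.
pose ge := [rel x y | le y x].
have ge_refl : reflexive ge by move=> x /=.
have ge_trans : transitive ge by move=> y x z /= yx zy; exact: le_trans zy yx.
have ge_total : total ge by move=> x y /=; exact: le_total.
case: (extremumP (P := mem A) id ge_refl ge_trans ge_total aA) => v vA vmax.
by exists v.
Qed.

(** The maximum of what remains is the immediate predecessor of [v]. This lets inductions follow the
    order without listing it as a sequence. *)
Lemma downset_pred (v : U) :
  downset v :\ v = set0 \/ exists2 u, le u v & downset v :\ v = downset u.
Proof.
case: (eqVneq (downset v :\ v) set0) => [->|/set_max[u]]; first by left.
rewrite !inE => /andP[neq_uv le_uv] umax; right; exists u => //.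
apply/setP=> z; rewrite !inE; apply/idP/idP => [/andP[neq_zv le_zv]|le_zu].
  by apply: umax; rewrite !inE neq_zv.
rewrite (le_trans le_zu le_uv) andbT; apply/eqP=> eq_zv.
by move: neq_uv; rewrite (le_anti (introT andP (conj le_uv _))) ?eqxx // -eq_zv.
Qed.

Lemma downset_last : (0 < #|U|)%N -> exists v, downset v = setT.
Proof.
rewrite -cardsT card_gt0 => /set_max[v _ vmax]; exists v.
by apply/setP=> u; rewrite !inE vmax ?inE.
Qed.

Lemma downset_self (v : U) : v \in downset v.
Proof. by rewrite inE. Qed.

Lemma downset_ind (P : U -> Prop) :
  (forall v, (forall u, le u v -> u != v -> P u) -> P v) -> forall v, P v.
Proof.
move=> IH v; have [n] := ubnP #|downset v|; elim: n v => // n IHn v.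
rewrite ltnS => szv; apply: IH => u le_uv neq_uv; apply: IHn.
apply: leq_trans szv; apply: proper_card; apply/properP; split.
  by apply/subsetP=> z; rewrite !inE => /le_trans; apply.
exists v; rewrite ?inE //; apply/negP=> le_vu.
by rewrite (le_anti (introT andP (conj le_uv le_vu))) eqxx in neq_uv.
Qed.

(** * Summation by parts when prefix sums are large at each drop of the weights *)

Section Abel.
Variables (a y : U -> R) (c w : R).
Let E (D : {set U}) : R := \sum_(u in D) y u.
Hypothesis a_anti : forall u v, le u v -> a v <= a u.
Hypothesis a_first : forall v, downset v :\ v = set0 -> c * w <= c * a v.
Hypothesis a_step : forall u v, downset v :\ v = downset u -> a v < a u ->
  c <= E (downset u).
Hypothesis a_last : forall v, downset v = setT -> 0 <= a v /\ (0 < a v -> c <= E setT).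

(* Summation by parts along the order. *)
Lemma weighted_sum_ge : (0 < #|U|)%N -> c * w <= \sum_u a u * y u.
Proof.
move=> U_gt0.
(* The first term is the boundary term of the summation by parts; the second collects [c] times
   every drop of [a] from the level [w] down to [a v]. *)
have main v : a v * E (downset v) + c * (w - a v) <= \sum_(u in downset v) a u * y u.
  elim/downset_ind: v => v IH.
  rewrite /E !(big_setD1 v (downset_self v)) /=.
  case: (downset_pred v) => [D0|[u le_uv Du]].
    by rewrite D0 !big_set0 !addr0; have := a_first D0; lra.
  rewrite Du -/(E _).
  have neq_uv : u != v.
    by have := downset_self u; rewrite -Du !inE => /andP[].
  have := IH u le_uv neq_uv; have auv := a_anti le_uv.
  have : 0 <= (a u - a v) * (E (downset u) - c).
    case: (ltrP (a v) (a u)) => [lt|ge].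
      by apply: mulr_ge0; rewrite subr_ge0 //; exact: a_step Du lt.
    have -> : a u = a v by apply/eqP; rewrite eq_le auv ge.
    by rewrite subrr mul0r.
  set X := E (downset u); set Z := \sum_(i in _) _.
  by rewrite mulrBr; lra.
have [v Dv] := downset_last U_gt0.
have := main v; have [av_ge0 av_pos] := a_last Dv.
rewrite Dv (eq_bigl _ _ (@in_setT _)).
move: av_ge0; rewrite le_eqVlt => /orP[/eqP<-|av_gt0].
  by rewrite mul0r add0r subr0.
have := mulr_ge0 (ltW av_gt0) (_ : 0 <= E setT - c); rewrite subr_ge0.
by move=> /(_ (av_pos av_gt0)); set Z := \sum_(i | _) _; lra.
Qed.
End Abel.

Section Greedy.
Variable f : {set U} -> R.
Hypotheses (f_mono : monotone f) (f_super : supermodular f) (f0 : f set0 = 0).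

Definition marginal (v : U) : R := f (downset v) - f (downset v :\ v).

Lemma marginal_ge0 v : 0 <= marginal v.
Proof. by rewrite subr_ge0; apply: f_mono; apply: subD1set. Qed.

(** The marginals telescope along the predecessors, so the greedy vertex is tight on prefixes. *)
Lemma sum_marginal v : \sum_(u in downset v) marginal u = f (downset v).
Proof.
elim/downset_ind: v => v IH.
rewrite (big_setD1 v (downset_self v)) /=.
case: (downset_pred v) => [D0|[u le_uv Du]].
  by rewrite /marginal D0 big_set0 addr0 f0 subr0.
have neq_uv : u != v by have := downset_self u; rewrite -Du !inE => /andP[].
by rewrite Du IH // /marginal Du subrK.
Qed.

(** Remove the last element [v] of [S]: supermodularity for [S] and the prefix before [v] bounds
    [f S - f (S :\ v)] by the marginal of [v]. *)
Lemma marginal_dom (S : {set U}) : f S <= \sum_(u in S) marginal u.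
Proof.
have [n] := ubnP #|S|; elim: n S => // n IH S; rewrite ltnS => szS.
case: (eqVneq S set0) => [->|S0]; first by rewrite f0 big_set0.
have [v vS vmax] := set_max S0.
rewrite (big_setD1 v vS) /=.
have := IH (S :\ v); have := f_super S (downset v :\ v).
have -> : S :|: downset v :\ v = downset v.
  apply/setP=> u; rewrite !inE; case: (eqVneq u v) => [->|_] /=.
    by rewrite vS le_refl.
  by apply/orP/idP => [[/vmax|]|->]; [| |right].
have -> : S :&: (downset v :\ v) = S :\ v.
  apply/setP=> u; rewrite !inE; case: (eqVneq u v) => [->|_] /=.
    by rewrite andbF.
  by apply/andP/idP => [[]|uS] //; split=> //; exact: vmax.
move=> h1 h2; have {}h2 := h2 _.
have : f (S :\ v) <= \sum_(u in S :\ v) marginal u.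
  by apply: h2; move: szS; rewrite (cardsD1 v S) vS.
by rewrite /marginal in h1 *; lra.
Qed.

End Greedy.
End TotalOrder.

(** * The Frank-Wolfe gap *)

Section WeightOrder.
Variables (R : realType) (U : finType).
Implicit Type b : U -> R.

(** Decreasing weight, ties broken by [enum_rank]. The nested negations copy the guard of
    [mark_cmd], as programs can only compare, negate and conjoin. *)
Definition heavier b : rel U := fun u v =>
  (b v <= b u) && ~~ ((b u <= b v) && ~~ (enum_rank u <= enum_rank v)%N).

Lemma heavier_refl b : reflexive (heavier b).
Proof. by move=> u; rewrite /heavier lexx leqnn. Qed.

Lemma heavier_trans b : transitive (heavier b).
Proof.
move=> v u w; rewrite /heavier => /andP[uv nuv] /andP[vw nvw].
rewrite (le_trans vw uv) /=; apply/negP=> /andP[wu nle].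
have vu : b u <= b v by apply: le_trans wu vw.
have wv : b v <= b w by apply: le_trans uv wu.
move: nuv nvw; rewrite vu wv /= !negbK => h1 h2.
by rewrite (leq_trans h1 h2) in nle.
Qed.

Lemma heavier_total b : total (heavier b).
Proof.
move=> u v; rewrite /heavier; case: (ltgtP (b u) (b v)) => //= _.
by rewrite !negbK leq_total.
Qed.

Lemma heavier_anti b : antisymmetric (heavier b).
Proof.
move=> u v; rewrite /heavier; case: (ltgtP (b u) (b v)) => //= _.
by rewrite !negbK -eqn_leq => /eqP/val_inj/enum_rank_inj.
Qed.

Lemma heavier_le b u v : heavier b u v -> b v <= b u.
Proof. by case/andP. Qed.

Definition before b (v : U) : {set U} := downset (heavier b) v :\ v.

Variable f : {set U} -> R.
Hypotheses (f_mono : monotone f) (f_super : supermodular f) (f0 : f set0 = 0).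

Definition greedy b (v : U) : R := marginal (heavier b) f v.

Lemma greedy_ge0 b v : 0 <= greedy b v.
Proof. exact: marginal_ge0. Qed.

Lemma f_ge0 S : 0 <= f S.
Proof. by rewrite -f0; apply: f_mono; apply: sub0set. Qed.

Lemma greedy_le b v : greedy b v <= f setT.
Proof.
rewrite /greedy /marginal lerBlDr -[leLHS]addr0; apply: lerD (f_ge0 _).
by apply: f_mono; apply: subsetT.
Qed.

Lemma greedy_dom b S : f S <= \sum_(u in S) greedy b u.
Proof.
apply: marginal_dom => //.
- exact: heavier_refl.
- exact: heavier_trans.
- exact: heavier_total.
Qed.

Lemma sum_greedy b v :
  \sum_(u in downset (heavier b) v) greedy b u = f (downset (heavier b) v).
Proof.
apply: sum_marginal => //.
- exact: heavier_refl.
- exact: heavier_trans.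
- exact: heavier_total.
- exact: heavier_anti.
Qed.

(** * Lower bound on the gap when all candidates fail *)

Section Gap.
Variables (b : U -> R) (T : {set U}).
Hypotheses (b_ge0 : forall u, 0 <= b u).
Hypothesis b_dom : forall S, f S <= \sum_(u in S) b u.
Variable lam : R.
Hypotheses (T0 : T != set0) (fT : f T = 2 * lam * #|T|%:R).
Hypothesis lam_gt : f setT < lam * #|U|%:R.

Let n : R := #|U|%:R.

Let U_gt0 : (0 < #|U|)%N.
Proof. by have /set0Pn[u _] := T0; apply/card_gt0P; exists u. Qed.

Let n_ge1 : 1 <= n.
Proof. by rewrite /n ler1n. Qed.

Let lam_gt0 : 0 < lam.
Proof. have := f_ge0 setT; have := n_ge1; move: lam_gt; rewrite -/n; nra. Qed.

(* Half of [lam] is available as slack because [S] either meets [T] or can be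
   enlarged by all of [T]. *)
Lemma not_approx_max (S : {set U}) : f S < lam * #|S :|: T|%:R ->
  exists W, f S - lam * #|S|%:R < f W - lam * #|W|%:R - lam / 2.
Proof.
move=> fS.
have cT : 1 <= #|T|%:R :> R by rewrite ler1n card_gt0.
have cUI : #|S :|: T|%:R + #|S :&: T|%:R = #|S|%:R + #|T|%:R :> R.
  by rewrite -!natrD cardsUI.
case: (eqVneq (S :&: T) set0) => [ST0|ST].
  exists (S :|: T); have := f_super S T.
  by move: cUI; rewrite ST0 cards0 f0 fT => cUI; have := lam_gt0; nra.
(* The hypothesis puts [f S - lam * #|S|] below [lam * (#|T| - #|S :&: T|)], while [T] attains
   [lam * #|T|]. *)
exists T; have : 1 <= #|S :&: T|%:R :> R by rewrite ler1n card_gt0.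
by rewrite fT; have := lam_gt0; nra.
Qed.

(** An error of [w] in every coordinate costs [lam / 4] in total, half of the slack of
    [not_approx_max]. *)
Let w : R := lam / (4 * n).

Let w_gt0 : 0 < w.
Proof. by apply: divr_gt0 => //; have := n_ge1; lra. Qed.

Let nw : n * w = lam / 4.
Proof. by rewrite /w; field; have := n_ge1; lra. Qed.

(** Compared with any [W], the set [D] loses at most [w] per element in the sum of [b u - lam], so
    the slack of [f] passes to [b(D) - f D]. The right side is split so that its second bracket
    vanishes when the greedy vertex is tight on [D]. *)
Lemma level_set_slack (D : {set U}) :
  (forall u, u \in D -> lam <= b u) -> (forall u, u \notin D -> b u <= lam + w) ->
  f D < lam * #|D :|: T|%:R -> lam / 4 <= \sum_(u in D) (b u - greedy b u) +
     (\sum_(u in D) greedy b u - f D).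
Proof.
move=> inD outD /not_approx_max[W fW].
rewrite sumrB; have bW := b_dom W.
have sumlam (A : {set U}) :
    \sum_(u in A) (b u - lam) = \sum_(u in A) b u - lam * #|A|%:R.
  by rewrite sumrB sumr_const mulr_natr.
have : \sum_(u in W) (b u - lam) <= \sum_(u in D) (b u - lam) + n * w.
  have -> : n * w = \sum_(u : U) w.
    by rewrite sumr_const mulr_natl.
  rewrite [X in X <= _]big_mkcond [X in _ <= X + _]big_mkcond /= -big_split /=.
  apply: ler_sum => u _.
  have := w_gt0; case: ifPn => uW; case: ifPn => [/inD|/outD]; lra.
by rewrite !sumlam nw; lra.
Qed.

(** Split [b] into the clamp [a] of [b - lam] to the interval from 0 to [w], and the rest. The clamp
    drops only at cuts to which [level_set_slack] applies, and contributes [lam / 4 * w]. The rest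
    is also nonnegative and antitone, and contributes at least 0. *)
Lemma large_gap :
  (forall v, f (before b v) < lam * #|before b v :|: T|%:R) ->
  lam ^+ 2 / (16 * n) <= \sum_u b u * (b u - greedy b u).
Proof.
move=> fail.
have -> : lam ^+ 2 / (16 * n) = lam / 4 * w.
  by rewrite /w; field; have := n_ge1; lra.
pose a u : R := Num.min (Num.max (b u - lam) 0) w.
have y_ge0 v : 0 <= \sum_(u in downset (heavier b) v) (b u - greedy b u).
  rewrite sumrB sum_greedy subr_ge0; exact: b_dom.
have yT : \sum_(u in setT) (b u - greedy b u) = \sum_(u in setT) b u - f setT.
  have [v <-] := downset_last (@heavier_refl b) (@heavier_trans b)
    (@heavier_total b) U_gt0.
  by rewrite sumrB sum_greedy.
have slack (D : {set U}) : (forall u, u \in D -> lam <= b u) ->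
    (forall u, u \notin D -> b u <= lam + w) -> f D < lam * #|D :|: T|%:R ->
    f D = \sum_(u in D) greedy b u ->
  lam / 4 <= \sum_(u in D) (b u - greedy b u).
  move=> h1 h2 h3 h4; have := level_set_slack h1 h2 h3.
  by rewrite -h4 subrr addr0.
have a_cases u : [\/ b u <= lam /\ a u = 0,
    lam <= b u <= lam + w /\ a u = b u - lam | lam + w <= b u /\ a u = w].
  rewrite /a; case: (leP (b u - lam) 0) => h1.
    by constructor 1; split; [lra | apply: min_l; apply: ltW].
  by case: (leP (b u - lam) w) => h2; [constructor 2|constructor 3]; lra.
have aP u : [/\ 0 <= a u, a u <= w, 0 < a u -> lam <= b u & a u < w -> b u <= lam + w].
  by have := w_gt0; case: (a_cases u) => -[? ->] ?; split=> *; lra.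
have a_mono u v : b v <= b u -> a v <= a u.
  by have := w_gt0; case: (a_cases u) => -[? ->]; case: (a_cases v) => -[? ->]; lra.
have main : lam / 4 * w <= \sum_u a u * (b u - greedy b u).
  apply: (weighted_sum_ge (@heavier_refl b) (@heavier_trans b)
     (@heavier_total b) (@heavier_anti b)) => //.
  - by move=> u v /heavier_le/a_mono.
  - move=> v D0.
    (* If the heaviest element had [a v < w], all weights would be at most [lam + w]. The empty set
       would then be a valid cut, but its slack is 0. *)
    case: (ltrP (a v) w) => [avw|]; last first.
      by move=> h; rewrite ler_pM2l //; have := lam_gt0; lra.
    have := slack set0 _ _ _ _; rewrite !big_set0 f0.
    have : f (before b v) < lam * #|before b v :|: T|%:R by apply: fail.
    rewrite /before D0 f0 => h /(_ _ _ h erefl) hh.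
    suff : lam / 4 <= 0 by have := lam_gt0; lra.
    apply: hh => [u|u _]; first by rewrite inE.
    have [_ _ _ /(_ avw) bv] := aP v.
    apply: le_trans bv.
    have := heavier_total b u v => /orP[uv|/heavier_le //].
    have : u \notin downset (heavier b) v :\ v by rewrite D0 inE.
    by rewrite !inE uv andbT negbK => /eqP->.
  (* At a drop, [0 < a u] puts the weights of the prefix above [lam], and [a v < w] puts the others
     below [lam + w]. *)
  - move=> u v Du auv; apply: slack.
    + move=> z; rewrite inE => /heavier_le bz.
      have [av0 _ _ _] := aP v; have [_ _ bu _] := aP u.
      by apply: le_trans bz; apply: bu; apply: le_lt_trans auv.
    + move=> z zD; have [_ auw _ _] := aP u; have [_ _ _ bv] := aP v.
      apply: le_trans (bv (lt_le_trans auv auw)).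
      have := heavier_total b z v => /orP[zv|/heavier_le //].
      by move: zD; rewrite -Du !inE zv andbT negbK => /eqP->.
    + by rewrite -Du; apply: fail.
    + by rewrite sum_greedy.
  (* The cut is now the whole universe, which is no proper prefix; [lam_gt] takes the place of
     [fail]. *)
  - move=> v Dv; have [av0 _ bv _] := aP v; split=> // av_gt0.
    have fsum : f setT = \sum_(u in setT) greedy b u.
      by move: yT; rewrite sumrB => /addrI/oppr_inj.
    apply: slack => //.
    + move=> z _; apply: le_trans (bv av_gt0) _.
      by apply: (@heavier_le b z v); have := in_setT z; rewrite -Dv inE.
    + by move=> z; rewrite inE.
    + by rewrite setTU cardsT.
(* With both constants 0, the summation by parts only asks for nonnegative prefix sums, that is, for
   [b_dom] on prefixes. *)
have rest : 0 * 0 <= \sum_u (b u - a u) * (b u - greedy b u).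
  apply: (weighted_sum_ge (@heavier_refl b) (@heavier_trans b)
     (@heavier_total b) (@heavier_anti b)) => //.
  - move=> u v /heavier_le; have := w_gt0.
    by case: (a_cases u) => -[? ->]; case: (a_cases v) => -[? ->]; lra.
  - by move=> v _; rewrite !mul0r.
  - move=> v Dv; split; last first.
      by rewrite -Dv => _; apply: y_ge0.
    have := b_ge0 v; have := w_gt0; have := lam_gt0.
    by case: (a_cases v) => -[? ->]; lra.
rewrite mul0r in rest.
have -> : \sum_u b u * (b u - greedy b u) =
  \sum_u a u * (b u - greedy b u) + \sum_u (b u - a u) * (b u - greedy b u).
  by rewrite -big_split /=; apply: eq_bigr => u _; ring.
by rewrite -[leLHS]addr0 lerD.
Qed.

End Gap.

End WeightOrder.

(** * Frank-Wolfe steps and completion *)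

Section Iteration.
Variables (R : realType) (U : finType) (f : {set U} -> R) (I : {set {set U}}).
Hypotheses (f_mono : monotone f) (f_super : supermodular f) (f0 : f set0 = 0).
Implicit Type b : U -> R.

Let n : R := #|U|%:R.
Let F : R := f setT.

(** The quotient of the gap bound [lam^2 / (16 n)] by the bound [n (lam n)^2] on the squared step
    direction. The unknown [lam] cancels. *)
Definition step_size : R := (16 * n ^+ 4)^-1.

Definition fw_step b : U -> R :=
  fun u => b u + step_size * (greedy f b u - b u).

(** The upper bound [F] is there to control the distance from [b] to the greedy vertex. *)
Definition dominating b : Prop :=
  (forall u, 0 <= b u <= F) /\ (forall S, f S <= \sum_(u in S) b u).

Lemma step_size_itv : 0 <= step_size <= 1.
Proof.
rewrite /step_size invr_ge0 mulr_ge0 ?exprn_ge0 ?ler0n //=.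
case: (posnP #|U|) => [U0|U_gt0].
  by rewrite /n U0 expr0n mulr0 invr0 ler01.
rewrite invf_le1.
  have : 1 <= n ^+ 4 by rewrite exprn_ege1 // ler1n.
  lra.
by rewrite mulr_gt0 // exprn_gt0 // ltr0n.
Qed.

(** The step is a convex combination with the greedy vertex, which obeys the same inequalities. *)
Lemma dominating_step b : dominating b -> dominating (fw_step b).
Proof.
case=> bF dom; have /andP[g0 g1] := step_size_itv; split.
  move=> u; have /andP[h1 h2] := bF u.
  have h3 := greedy_ge0 f_mono b u; have h4 := greedy_le f_mono f0 b u.
  rewrite /fw_step; apply/andP; split; rewrite -/F in h4 *; nra.
move=> S; have h1 := dom S; have h2 := greedy_dom f_super f0 b S.
have -> : \sum_(u in S) fw_step b u = \sum_(u in S) b u +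
   step_size * (\sum_(u in S) greedy f b u - \sum_(u in S) b u).
  by rewrite big_split -mulr_sumr sumrB.
nra.
Qed.

Lemma dominating_const : dominating (fun=> F).
Proof.
have F0 : 0 <= F by apply: f_ge0.
split=> [u|S]; first by rewrite F0 lexx.
case: (eqVneq S set0) => [->|S0]; first by rewrite f0 big_set0.
rewrite sumr_const; apply: le_trans (f_mono (subsetT S)) _.
by rewrite -/F -[leLHS]mulr1n; apply: ler_wpMn2l => //; rewrite card_gt0.
Qed.

(** The algorithm does not know the optimum, so the potential bound is kept for all feasible [T] at
    once. The first alternative persists because the density of the best set never decreases. *)
Definition progress (B : {set U}) b (c : nat) : Prop :=
  forall T, T != set0 -> feasible I T ->
  let lam := density f T / 2 in
  lam <= density f B \/
  \sum_u b u ^+ 2 <= n * F ^+ 2 - c%:R * (lam ^+ 2 / (256 * n ^+ 5)).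

Lemma progress0 B : progress B (fun=> F) 0.
Proof.
by move=> T _ _; right; rewrite mul0r subr0 sumr_const mulr_natl.
Qed.

Lemma progress_step (B B' : {set U}) b c :
  dominating b -> density f setT <= density f B ->
  density f B <= density f B' ->
  (forall v T, T != set0 -> feasible I T ->
     f (before b v) <= density f B' * #|before b v :|: T|%:R) ->
  progress B b c -> progress B' (fw_step b) c.+1.
Proof.
case=> bF dom BT BB' cand prog T T0 feasT lam.
case: (prog T T0 feasT) => [lamB|]; first by left; apply: le_trans BB'.
rewrite -/lam => pot.
case: (lerP lam (density f B')) => [|lamB]; [by left | right].
have U_gt0 : (0 < #|U|)%N.
  by have /set0Pn[u _] := T0; apply/card_gt0P; exists u.
have n_ge1 : 1 <= n by rewrite ler1n.
have n_gt0 : 0 < n by lra.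
have T_gt0 : 0 < #|T|%:R :> R by rewrite ltr0n card_gt0.
have fT : f T = 2 * lam * #|T|%:R by rewrite /lam /density; field; lra.
have lam_gt : F < lam * n.
  rewrite -ltr_pdivrMr //; apply: le_lt_trans lamB.
  by apply: le_trans BB'; apply: le_trans BT; rewrite /density cardsT.
have F0 : 0 <= F by apply: f_ge0.
have lam_gt0 : 0 < lam by nra.
have gap : lam ^+ 2 / (16 * n) <= \sum_u b u * (b u - greedy f b u).
  apply: (large_gap f_mono f_super f0 _ dom T0 fT lam_gt) => v.
    by have /andP[] := bF v.
  apply: le_lt_trans (cand v T T0 feasT) _; rewrite ltr_pM2r // ltr0n card_gt0.
  by apply/set0Pn; have /set0Pn[u uT] := T0; exists u; rewrite inE uT orbT.
(* Both points lie between 0 and [F] in each coordinate, and [F < lam * n]. *)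
have norm : \sum_u (greedy f b u - b u) ^+ 2 <= n * (lam * n) ^+ 2.
  have -> : n * (lam * n) ^+ 2 = \sum_(u : U) (lam * n) ^+ 2.
    by rewrite sumr_const mulr_natl.
  apply: ler_sum => u _; have /andP[h1 h2] := bF u.
  have h3 := greedy_ge0 f_mono b u; have h4 := greedy_le f_mono f0 b u.
  rewrite -/F in h4; nra.
have -> : \sum_u fw_step b u ^+ 2 = \sum_u b u ^+ 2
    - 2 * step_size * (\sum_u b u * (b u - greedy f b u))
    + step_size ^+ 2 * (\sum_u (greedy f b u - b u) ^+ 2).
  rewrite !mulr_sumr -sumrB -big_split /=; apply: eq_bigr => u _.
  by rewrite /fw_step; ring.
have /andP[g0 _] := step_size_itv.
have h1 := ler_wpM2l g0 gap; have h2 := ler_wpM2l (exprn_ge0 2 g0) norm.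
(* The gain is at least twice this quantity and the quadratic loss at most once, so one copy remains
   as the decrease. *)
have e1 : step_size * (lam ^+ 2 / (16 * n)) = lam ^+ 2 / (256 * n ^+ 5).
  by rewrite /step_size; field; lra.
have e2 : step_size ^+ 2 * (n * (lam * n) ^+ 2) = lam ^+ 2 / (256 * n ^+ 5).
  by rewrite /step_size; field; lra.
rewrite e1 in h1; rewrite e2 in h2.
rewrite -[c.+1]addn1 natrD; move: pot h1 h2.
set d := lam ^+ 2 / _; rewrite -/d; move: d => d; lra.
Qed.

(** Were [B] too sparse, the total decrease would be [n (lam n)^2], more than the initial [n F^2],
    and the squared norm would be negative. *)
Lemma progress_end B b : 0 <= density f B -> density f setT <= density f B ->
  progress B b (256 * #|U| ^ 8) -> forall T, T != set0 -> feasible I T ->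
  2^-1 * density f T <= density f B.
Proof.
move=> B0 BT prog T T0 feasT; rewrite mulrC.
case: (prog T T0 feasT) => // pot.
case: lerP => // lamB; exfalso.
have U_gt0 : (0 < #|U|)%N.
  by have /set0Pn[u _] := T0; apply/card_gt0P; exists u.
have n_gt0 : 0 < n by rewrite ltr0n.
set lam := density f T / 2 in pot lamB.
have lam_gt : F < lam * n.
  rewrite -ltr_pdivrMr //; apply: le_lt_trans lamB.
  by apply: le_trans BT; rewrite /density cardsT.
have F0 : 0 <= F by apply: f_ge0.
have : 0 <= \sum_u b u ^+ 2 by apply: sumr_ge0 => u _; apply: sqr_ge0.
apply/negP; rewrite -ltNge; apply: le_lt_trans pot _.
rewrite natrM natrX -/n.
have -> : 256 * n ^+ 8 * (lam ^+ 2 / (256 * n ^+ 5)) = n * (lam * n) ^+ 2.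
  by field; lra.
rewrite subr_lt0 ltr_pM2l // ltr_pXn2r // nnegrE //; nra.
Qed.

(** * Density of the completed candidates *)

Hypothesis I_matroid : matroid I.

(** The set [~: (S :|: T)] is independent; were it larger than [A], the extension property would add
    to [A] an element outside [S], against maximality. Hence [~: A] has at most [#|S :|: T|]
    elements, and [f] on it is at least [f S]. *)
Lemma completion_density (S A T : {set U}) :
  A \in I -> S \subset ~: A ->
  (forall u, u \notin S -> u \notin A -> u |: A \notin I) ->
  feasible I T -> f S <= density f (~: A) * #|S :|: T|%:R.
Proof.
move=> AI SA Amax feasT; have [I_sub I_aug] := I_matroid.
have TI : ~: (S :|: T) \in I.
  by apply: I_sub feasT; rewrite setCS subsetUr.
have le_card : (#|~: A| <= #|S :|: T|)%N.
  rewrite leqNgt; apply/negP => lt.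
  have ltA : (#|A| < #|~: (S :|: T)|)%N.
    by have := cardsC A; have := cardsC (S :|: T); lia.
  have [x] := I_aug _ _ AI TI ltA.
  by rewrite !inE negb_or => /andP[xA /andP[xS _]]; apply/negP/Amax.
have fSA := f_mono SA.
case: (posnP #|~: A|) => [/eqP|A_gt0].
  rewrite cards_eq0 => /eqP A0; move: fSA; rewrite A0 f0 => fS.
  by rewrite /density f0 mul0r mul0r.
apply: le_trans fSA _; rewrite /density mulrAC ler_pdivlMr ?ltr0n //.
by apply: ler_wpM2l; [apply: f_ge0 | rewrite ler_nat].
Qed.

End Iteration.

(** * Weakest preconditions *)

#[local] Arguments upd : simpl never.

Definition nvar (a : nat) : iexp := IGet a (IConst 0) (IConst 0).
Definition rvar (a : nat) : rexp := RGet a (IConst 0) (IConst 0).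
Definition setn (a : nat) (e : iexp) : cmd := CSetI a (IConst 0) (IConst 0) e.
Definition setr (a : nat) (e : rexp) : cmd := CSetR a (IConst 0) (IConst 0) e.

Definition for_loop (c : nat) (body : cmd) : cmd :=
  CSeq (setn c (IConst 0))
    (CWhile (BNot (BLeI ICard (nvar c)))
       (CSeq body (setn c (IAdd (nvar c) (IConst 1))))).

Section WeakestPrecondition.
Variables (R : realType) (U : finType) (f : {set U} -> R) (I : {set {set U}}).
Implicit Types (s : state R) (Q : state R -> Prop) (m : memory nat).

(** Time is only bounded above, so that all rounds of a loop can share one bound. *)
Definition wp (c : cmd) s (t : nat) Q : Prop :=
  exists t' s', [/\ exec f I c s t' s', (t' <= t)%N & Q s'].

Lemma wp_mono c s t t' Q Q' : wp c s t Q -> (t <= t')%N ->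
  (forall s', Q s' -> Q' s') -> wp c s t' Q'.
Proof.
move=> [t1 [s1 [ex le q]]] le' QQ'; exists t1, s1; split=> //; last exact: QQ'.
exact: leq_trans le'.
Qed.

Lemma wp_skip s Q : Q s -> wp CSkip s 1 Q.
Proof. by move=> q; exists 1%N, s; split=> //; constructor. Qed.

Lemma wp_setI a i j e s Q :
  Q (State (upd (imem s) a (ieval #|U| (imem s) i) (ieval #|U| (imem s) j)
       (ieval #|U| (imem s) e)) (rmem s)) -> wp (CSetI a i j e) s 1 Q.
Proof. by move=> q; eexists _, _; split; [constructor| |exact: q]. Qed.

Lemma wp_setR a i j e s Q :
  Q (State (imem s) (upd (rmem s) a (ieval #|U| (imem s) i)
       (ieval #|U| (imem s) j) (reval #|U| s e))) -> wp (CSetR a i j e) s 1 Q.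
Proof. by move=> q; eexists _, _; split; [constructor| |exact: q]. Qed.

Lemma wp_value a i j b k s Q :
  Q (State (imem s) (upd (rmem s) a (ieval #|U| (imem s) i)
       (ieval #|U| (imem s) j)
       (f (coded_set U (imem s) b (ieval #|U| (imem s) k))))) ->
  wp (CValue a i j b k) s 1 Q.
Proof. by move=> q; eexists _, _; split; [constructor| |exact: q]. Qed.

Lemma wp_indep a i j b k s Q :
  Q (State (upd (imem s) a (ieval #|U| (imem s) i) (ieval #|U| (imem s) j)
       (coded_set U (imem s) b (ieval #|U| (imem s) k) \in I : nat))
       (rmem s)) ->
  wp (CIndep a i j b k) s 1 Q.
Proof. by move=> q; eexists _, _; split; [constructor| |exact: q]. Qed.

Lemma wp_seq c1 c2 s t1 t2 Q :
  wp c1 s t1 (fun s1 => wp c2 s1 t2 Q) -> wp (CSeq c1 c2) s (t1 + t2) Q.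
Proof.
move=> [t1' [s1 [ex1 le1 [t2' [s2 [ex2 le2 q]]]]]].
exists (t1' + t2')%N, s2; split=> //; last exact: leq_add.
exact: ExecSeq ex1 ex2.
Qed.

Lemma wp_if b c1 c2 s t1 t2 Q :
  (beval #|U| s b -> wp c1 s t1 Q) -> (~~ beval #|U| s b -> wp c2 s t2 Q) ->
  wp (CIf b c1 c2) s (t1 + t2).+1 Q.
Proof.
case hb: (beval #|U| s b) => h1 h2.
  have [t [s' [ex le q]]] := h1 isT; exists t.+1, s'; split=> //.
    by apply: ExecIf; rewrite hb.
  by rewrite ltnS; apply: leq_trans le (leq_addr _ _).
have [t [s' [ex le q]]] := h2 isT; exists t.+1, s'; split=> //.
  by apply: ExecIf; rewrite hb.
by rewrite ltnS; apply: leq_trans le (leq_addl _ _).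
Qed.

(** The index of [J] counts the finished rounds and decides the guard, which fixes the number of
    rounds and gives termination. *)
Lemma wp_while (b : bexp) c t N (J : nat -> state R -> Prop) :
  (forall k s, J k s -> beval #|U| s b = (k < N)%N) ->
  (forall k s, (k < N)%N -> J k s -> wp c s t (J k.+1)) ->
  forall k s, (k <= N)%N -> J k s -> wp (CWhile b c) s ((N - k) * t.+1).+1 (J N).
Proof.
move=> guard body k s lekN; have [d dE] : exists d, d = (N - k)%N by eexists.
elim: d k s dE lekN => [|d IH] k s dE lekN Jk; rewrite -dE.
  have kN : k = N by lia.
  exists 1%N, s; split=> //; last by rewrite -kN.
  by apply: ExecWhileStop; rewrite (guard k s Jk) kN ltnn.
have ltkN : (k < N)%N by lia.
have [t1 [s1 [ex1 le1 J1]]] := body k s ltkN Jk.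
have [t2 [s2 [ex2 le2 J2]]] := IH k.+1 s1 ltac:(lia) ltkN J1.
exists (t1 + t2).+1, s2; split=> //.
  by apply: ExecWhileLoop ex1 ex2; rewrite (guard k s Jk).
have eqd : (N - k.+1)%N = d by lia.
by rewrite eqd in le2; rewrite mulSn; lia.
Qed.

Definition set_counter (c k : nat) s : state R :=
  State (upd (imem s) c 0 0 k) (rmem s).

Lemma upd_same (T : Type) (m : memory T) a i j x : upd m a i j x a i j = x.
Proof. by rewrite /upd !eqxx. Qed.

Lemma upd_other (T : Type) (m : memory T) a i j x a' :
  a' != a -> upd m a i j x a' = m a'.
Proof. by rewrite /upd => /negbTE->. Qed.

(** Rounds correspond to elements through [enum_rank]. The first premise makes [J] insensitive to
    the counter; each round adds an increment and a test to the body. *)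
Lemma wp_for c body t (J : nat -> state R -> Prop) s Q :
  (forall k x s, J k s -> J k (set_counter c x s)) ->
  J 0%N s ->
  (forall (v : U) s, imem s c 0%N 0%N = enum_rank v -> J (enum_rank v) s ->
     wp body s t (fun s' => imem s' c 0%N 0%N = enum_rank v /\ J (enum_rank v).+1 s')) ->
  (forall s', J #|U| s' -> Q s') ->
  wp (for_loop c body) s (#|U| * t.+2).+2 Q.
Proof.
move=> stable J0 step post.
have -> : (#|U| * t.+2).+2 = (1 + ((#|U| - 0) * (t + 1).+1).+1)%N.
  by rewrite subn0 addn1.
apply: wp_seq; apply: wp_setI => /=.
pose J' k s := imem s c 0%N 0%N = k /\ J k s.
apply: (@wp_mono _ _ ((#|U| - 0) * (t + 1).+1).+1 _ (J' #|U|)).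
- apply: (wp_while (J := J')) => //.
  + by move=> k s' [/= -> _]; rewrite -ltnNge.
  + move=> k s' ltk [ck Jk].
    pose v := enum_val (Ordinal ltk).
    have vk : enum_rank v = k :> nat by rewrite enum_valK.
    apply: wp_seq; apply: (@wp_mono _ _ t t _ _ (step v s' _ _)) => //.
    - by rewrite vk.
    - by rewrite vk.
    move=> s1 [c1 J1]; apply: wp_setI => /=; split.
      by rewrite /= upd_same c1 vk addn1.
    by rewrite -vk; apply: (stable _ _ s1).
  + by split; [rewrite /= upd_same | exact: stable].
- exact: leqnn.
- by move=> s' [_ /post].
Qed.

(** * Frame conditions and loops filling a row *)

Definition frameI (X : seq nat) s s' : Prop :=
  forall a, a \notin X -> imem s' a = imem s a.

Definition frameR (X : seq nat) s s' : Prop :=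
  forall a, a \notin X -> rmem s' a = rmem s a.

Lemma frameI_trans X Y Z s1 s2 s3 : all (mem Z) X -> all (mem Z) Y ->
  frameI X s1 s2 -> frameI Y s2 s3 -> frameI Z s1 s3.
Proof.
move=> /allP XZ /allP YZ h1 h2 a aZ; rewrite h2 ?h1 //.
  by apply: contra aZ; apply: XZ.
by apply: contra aZ; apply: YZ.
Qed.

Lemma frameR_trans X Y Z s1 s2 s3 : all (mem Z) X -> all (mem Z) Y ->
  frameR X s1 s2 -> frameR Y s2 s3 -> frameR Z s1 s3.
Proof.
move=> /allP XZ /allP YZ h1 h2 a aZ; rewrite h2 ?h1 //.
  by apply: contra aZ; apply: XZ.
by apply: contra aZ; apply: YZ.
Qed.

Lemma frameI_eq X s s' : imem s' = imem s -> frameI X s s'.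
Proof. by move=> e a _; rewrite e. Qed.

Lemma frameR_eq X s s' : rmem s' = rmem s -> frameR X s s'.
Proof. by move=> e a _; rewrite e. Qed.

(** The body may assume that its own cell still has the original value, so rows can also be
    transformed in place. *)
Lemma wp_fillI c a body t (g : U -> nat) s Q : a != c ->
  (forall v s1, frameI [:: a; c] s s1 -> rmem s1 = rmem s ->
     imem s1 c 0%N 0%N = enum_rank v ->
     imem s1 a 0%N (enum_rank v) = imem s a 0%N (enum_rank v) ->
     wp body s1 t (fun s2 =>
       s2 = State (upd (imem s1) a 0 (enum_rank v) (g v)) (rmem s1))) ->
  (forall s', frameI [:: a; c] s s' -> rmem s' = rmem s ->
     (forall u, imem s' a 0%N (enum_rank u) = g u) -> Q s') ->
  wp (for_loop c body) s (#|U| * t.+2).+2 Q.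
Proof.
move=> neq_ac step post.
apply: (wp_for (J := fun k s' => [/\ frameI [:: a; c] s s', rmem s' = rmem s &
   forall u, imem s' a 0%N (enum_rank u) =
     if (enum_rank u < k)%N then g u else imem s a 0%N (enum_rank u)])).
- move=> k x s' [h1 h2 h3]; rewrite /set_counter; split=> //= [b|u].
    by rewrite !inE negb_or => /andP[ba bc]; rewrite /= upd_other // h1 // !inE negb_or ba.
  by rewrite upd_other.
- by split.
- move=> v s1 cv [h1 h2 h3].
  apply: wp_mono (step v s1 h1 h2 cv _) (leqnn _) _; first by rewrite h3 ltnn.
  move=> _ ->; split=> /=; first by rewrite upd_other // eq_sym.
  split=> //= [b|u].
    rewrite !inE negb_or => /andP[ba bc].
    by rewrite /= upd_other // h1 // !inE negb_or ba.
  rewrite /upd !eqxx /= ltnS leq_eqVlt h3.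
  case: eqP => [/val_inj/enum_rank_inj->|_] //.
- by move=> s' [h1 h2 h3]; apply: post => // u; rewrite h3 ltn_ord.
Qed.

Lemma wp_fillR c a body t (g : U -> R) s Q :
  (forall v s1, frameI [:: c] s s1 -> frameR [:: a] s s1 ->
     imem s1 c 0%N 0%N = enum_rank v ->
     rmem s1 a 0%N (enum_rank v) = rmem s a 0%N (enum_rank v) ->
     wp body s1 t (fun s2 =>
       s2 = State (imem s1) (upd (rmem s1) a 0 (enum_rank v) (g v)))) ->
  (forall s', frameI [:: c] s s' -> frameR [:: a] s s' ->
     (forall u, rmem s' a 0%N (enum_rank u) = g u) -> Q s') ->
  wp (for_loop c body) s (#|U| * t.+2).+2 Q.
Proof.
move=> step post.
apply: (wp_for (J := fun k s' => [/\ frameI [:: c] s s', frameR [:: a] s s' &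
   forall u, rmem s' a 0%N (enum_rank u) =
     if (enum_rank u < k)%N then g u else rmem s a 0%N (enum_rank u)])).
- move=> k x s' [h1 h2 h3]; rewrite /set_counter; split=> //= b hb.
  by rewrite /= upd_other ?h1 //; rewrite !inE in hb.
- by split.
- move=> v s1 cv [h1 h2 h3].
  apply: wp_mono (step v s1 h1 h2 cv _) (leqnn _) _; first by rewrite h3 ltnn.
  move=> _ ->; split=> //=; split=> //= [b|u].
    by move=> hb; rewrite /= upd_other ?h2 //; rewrite !inE in hb.
  rewrite /upd !eqxx /= ltnS leq_eqVlt h3.
  case: eqP => [/val_inj/enum_rank_inj->|_] //.
- by move=> s' [h1 h2 h3]; apply: post => // u; rewrite h3 ltn_ord.
Qed.

Lemma coded_set_upd m a v x :
  coded_set U (upd m a 0 (enum_rank v) x) a 0 =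
  if x != 0%N then v |: coded_set U m a 0 else coded_set U m a 0 :\ v.
Proof.
apply/setP=> u; rewrite [LHS]inE /upd !eqxx /=.
rewrite (inj_eq val_inj) (inj_eq enum_rank_inj).
by case: (eqVneq x 0%N) => [->|x0]; case: (eqVneq u v) => [->|neq_uv];
  rewrite !inE ?eqxx ?x0 ?(negbTE neq_uv).
Qed.

Lemma coded_set_upd_other m a i j x a' : a' != a ->
  coded_set U (upd m a i j x) a' 0 = coded_set U m a' 0.
Proof. by move=> neq; rewrite /coded_set upd_other. Qed.

End WeakestPrecondition.

(** * The program *)

(* Natural arrays: 0 best set so far, 1 current candidate, 2 its completion,
   3 and 4 loop counters, 5 oracle answer.
   Real arrays: 0 weights, 1 greedy vertex, 2 [#|U|], 3 [f U], 4 density of the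
   best set, 5 step size, 6 number of iterations, 7 iteration counter,
   8 value or density of the candidate, 9 size of the completion. *)

Definition mark_cmd : cmd :=
  let bu := RGet 0 (IConst 0) (nvar 4) in
  let bv := RGet 0 (IConst 0) (nvar 3) in
  for_loop 4
    (CIf (BAnd (BLeR bv bu)
            (BNot (BAnd (BLeR bu bv) (BNot (BLeI (nvar 4) (nvar 3))))))
       (CSetI 1 (IConst 0) (nvar 4) (IConst 1))
       (CSetI 1 (IConst 0) (nvar 4) (IConst 0))).

(** No expression turns a natural into a real, so the size of the completion is counted down in a
    real cell. *)
Definition independent_cmd : cmd :=
  for_loop 4
    (CIf (BLeI (IGet 1 (IConst 0) (nvar 4)) (IConst 0))
       (CSeq (CSetI 2 (IConst 0) (nvar 4) (IConst 1))
       (CSeq (CIndep 5 (IConst 0) (IConst 0) 2 (IConst 0))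
         (CIf (BLeI (nvar 5) (IConst 0))
           (CSetI 2 (IConst 0) (nvar 4) (IConst 0))
           (setr 9 (RAdd (rvar 9) (ROpp ROne))))))
       CSkip).

Definition complete_cmd : cmd :=
  CSeq (for_loop 4 (CSetI 2 (IConst 0) (nvar 4) (IConst 0)))
  (CSeq (setr 9 (rvar 2))
  (CSeq independent_cmd
    (for_loop 4 (CSetI 2 (IConst 0) (nvar 4)
       (ISub (IConst 1) (IGet 2 (IConst 0) (nvar 4))))))).

Definition candidate_cmd : cmd :=
  CSeq complete_cmd
  (CSeq (CValue 8 (IConst 0) (IConst 0) 2 (IConst 0))
  (CSeq (setr 8 (RMul (rvar 8) (RInv (rvar 9))))
    (CIf (BLeR (rvar 8) (rvar 4)) CSkip
       (CSeq (setr 4 (rvar 8))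
         (for_loop 4 (CSetI 0 (IConst 0) (nvar 4)
            (IGet 2 (IConst 0) (nvar 4)))))))).

(** Nothing is sorted: the prefix ending at each element is marked afresh. Removing that element
    then yields both its marginal value and the candidate. *)
Definition vertex_cmd : cmd :=
  for_loop 3
   (CSeq mark_cmd
   (CSeq (CValue 8 (IConst 0) (IConst 0) 1 (IConst 0))
   (CSeq (CSetI 1 (IConst 0) (nvar 3) (IConst 0))
   (CSeq (CValue 1 (IConst 0) (nvar 3) 1 (IConst 0))
   (CSeq (CSetR 1 (IConst 0) (nvar 3)
           (RAdd (rvar 8) (ROpp (RGet 1 (IConst 0) (nvar 3)))))
     candidate_cmd))))).

Definition update_cmd : cmd :=
  let bv := RGet 0 (IConst 0) (nvar 3) in
  for_loop 3 (CSetR 0 (IConst 0) (nvar 3)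
    (RAdd bv (RMul (rvar 5) (RAdd (RGet 1 (IConst 0) (nvar 3)) (ROpp bv))))).

Definition rsquare (e : rexp) : rexp := RMul e e.

(** Cell 6 first receives [(2 n)^4 = 16 n^4], whose inverse is the step size, and then its square
    [256 n^8], the number of iterations. These are reals because naturals cannot be multiplied. *)
Definition init_cmd : cmd :=
  CSeq (for_loop 3 (CSeq (CSetI 0 (IConst 0) (nvar 3) (IConst 1))
          (setr 2 (RAdd (rvar 2) ROne))))
  (CSeq (CValue 3 (IConst 0) (IConst 0) 0 (IConst 0))
  (CSeq (setr 4 (RMul (rvar 3) (RInv (rvar 2))))
  (CSeq (for_loop 3 (CSetR 0 (IConst 0) (nvar 3) (rvar 3)))
  (CSeq (setr 6 (rsquare (rsquare (RAdd (rvar 2) (rvar 2)))))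
  (CSeq (setr 5 (RInv (rvar 6)))
    (setr 6 (rsquare (rvar 6)))))))).

Definition densest_cmd : cmd :=
  CSeq init_cmd
    (CWhile (BNot (BLeR (rvar 6) (rvar 7)))
      (CSeq vertex_cmd (CSeq update_cmd (setr 7 (RAdd (rvar 7) ROne))))).

(** * Correctness and running time of the program *)

Section Correctness.
Variables (R : realType) (U : finType) (f : {set U} -> R) (I : {set {set U}}).
Implicit Types (s : state R) (Q : state R -> Prop).

Definition weights s : U -> R := fun u => rmem s 0%N 0%N (enum_rank u).

Definition row s (a : nat) : {set U} := coded_set U (imem s) a 0.

Lemma wp_mark s (v : U) Q : imem s 3%N 0%N 0%N = enum_rank v ->
  (forall s', frameI [:: 1%N; 4%N] s s' -> rmem s' = rmem s ->
     row s' 1 = downset (heavier (weights s)) v -> Q s') ->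
  wp f I mark_cmd s (#|U| * 5).+2 Q.
Proof.
move=> sv post.
apply: (wp_fillI (a := 1) (g := fun u => heavier (weights s) u v : nat)) => //.
  move=> u s1 fr rm s1u _.
  have s1v : imem s1 3%N 0%N 0%N = enum_rank v by rewrite fr.
  have guard : beval #|U| s1 (BAnd
      (BLeR (RGet 0 (IConst 0) (nvar 3)) (RGet 0 (IConst 0) (nvar 4)))
      (BNot (BAnd (BLeR (RGet 0 (IConst 0) (nvar 4)) (RGet 0 (IConst 0) (nvar 3)))
         (BNot (BLeI (nvar 4) (nvar 3)))))) = heavier (weights s) u v.
    by rewrite /= s1u s1v rm.
  by apply: (wp_if (t1 := 1) (t2 := 1)); rewrite guard => h;
    apply: wp_setI; rewrite /= s1u ?h ?(negbTE h).
move=> s' fr rm g; apply: post => //.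
apply/setP=> u; rewrite !inE g; by case: heavier.
Qed.

Hypothesis I_sub : forall A B : {set U}, A \subset B -> B \in I -> A \in I.

(** One pass is enough for maximality: by closure under subsets, an element rejected once stays
    rejected as [A] grows. *)
Lemma wp_independent s Q : row s 2 = set0 -> rmem s 9%N 0%N 0%N = #|U|%:R ->
  (forall s' (A : {set U}), frameI [:: 2%N; 4%N; 5%N] s s' -> frameR [:: 9%N] s s' ->
     row s' 2 = A -> rmem s' 9%N 0%N 0%N = #|~: A|%:R ->
     row s 1 \subset ~: A -> (set0 \in I -> A \in I) ->
     (forall u, u \notin row s 1 -> u \notin A -> u |: A \notin I) -> Q s') ->
  wp f I independent_cmd s (#|U| * 9).+2 Q.
Proof.
move=> s2 s9 post.
pose J (k : nat) s' := exists A : {set U},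
  [/\ frameI [:: 2%N; 4%N; 5%N] s s', frameR [:: 9%N] s s', row s' 2 = A
   & rmem s' 9%N 0%N 0%N = #|~: A|%:R] /\
  [/\ row s 1 \subset ~: A, set0 \in I -> A \in I,
      forall u, u \in A -> (enum_rank u < k)%N &
      forall u, u \notin row s 1 -> (enum_rank u < k)%N -> u \notin A ->
        u |: A \notin I].
apply: (wp_for (J := J)).
- move=> k x s' [A [[h1 h2 h3 h4] h]]; exists A; split=> //; split=> //= b hb.
  rewrite /set_counter /= upd_other ?h1 //.
  by move: hb; rewrite !inE !negb_or => /and3P[].
- exists set0; split; first by split=> //; rewrite setC0 cardsT.
  by split=> // [|u]; rewrite ?setC0 ?subsetT // inE.
- move=> v s1 s1v [A [[h1 h2 h3 h4] [h5 h6 h7 h8]]].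
  have vA : v \notin A by apply/negP=> /h7; rewrite ltnn.
  have guard : beval #|U| s1 (BLeI (IGet 1 (IConst 0) (nvar 4)) (IConst 0))
      = (v \notin row s 1).
    by rewrite inE /= s1v h1 // leqn0 negbK.
  apply: (wp_if (t1 := 5) (t2 := 1)); rewrite guard => hv; last first.
    apply: wp_skip; split=> //; exists A; split=> //; split=> // u.
      by move/h7/leqW.
    move=> us; rewrite ltnS leq_eqVlt => /orP[/eqP/val_inj/enum_rank_inj uv|];
      last exact: h8.
    by rewrite -uv us in hv.
  apply: (wp_seq (t1 := 1) (t2 := 4)); apply: wp_setI.
  apply: (wp_seq (t1 := 1) (t2 := 3)); apply: wp_indep.
  rewrite /= s1v coded_set_upd /= -/(row s1 2) h3.
  apply: (wp_if (t1 := 1) (t2 := 1)); rewrite /= upd_same => hI.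
    apply: wp_setI; split; rewrite /= ?upd_other //= ?upd_other //= ?s1v //.
    have {}hI : v |: A \notin I by move: hI; case: (_ \in I).
    exists A; split.
      split=> //=.
      + move=> a ha; have /h1 <- := ha; move: ha; rewrite !inE !negb_or.
        by case/and3P=> ? ? ?; rewrite /= !upd_other.
      + rewrite /row coded_set_upd /=.
        by rewrite coded_set_upd_other // coded_set_upd /= -/(row s1 2) h3 setU1K.
    split=> // u; first by move/h7/leqW.
    move=> us; rewrite ltnS leq_eqVlt => /orP[/eqP/val_inj/enum_rank_inj->//|].
    exact: h8.
  apply: wp_setR; split; rewrite /= ?upd_other //= ?upd_other //.
  have {}hI : v |: A \in I by move: hI; case: (_ \in I).
  exists (v |: A); split.
    split=> //=.
    + move=> a ha; have /h1 <- := ha; move: ha; rewrite !inE !negb_or.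
      by case/and3P=> ? ? ?; rewrite /= !upd_other.
    + by move=> a ha; have /h2 <- := ha; rewrite /= upd_other //; rewrite inE in ha.
    + by rewrite /row coded_set_upd_other // coded_set_upd /= -/(row s1 2) h3.
    + have -> : #|~: (v |: A)| = #|~: A|.-1.
        by have := cardsC A; have := cardsC (v |: A); rewrite cardsU1 vA; lia.
      rewrite upd_same h4 -subn1 natrB // card_gt0.
      by apply/set0Pn; exists v; rewrite inE.
  split=> //.
  + by rewrite setCU subsetI h5 andbT subsetC sub1set inE.
  + move=> u; rewrite !inE => /orP[/eqP->//|/h7/leqW//].
  + move=> u us; rewrite ltnS leq_eqVlt inE negb_or =>
      /orP[/eqP/val_inj/enum_rank_inj->|lt /andP[uv uA]]; first by rewrite inE eqxx.
    apply: contra (h8 u us lt uA); apply: I_sub.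
    by apply: setUS; apply: subsetUr.
- move=> s' [A [[h1 h2 h3 h4] [h5 h6 h7 h8]]].
  by apply: (post s' A) => // u us uA; apply: h8.
Qed.


Lemma row_frame X s s' a : frameI X s s' -> a \notin X -> row s' a = row s a.
Proof. by move=> fr aX; rewrite /row /coded_set fr. Qed.

(** Here [~: B] is a maximal independent subset of [~: S], unless [I] is empty; the premise
    [set0 \in I] covers that case. *)
Definition completes (S B : {set U}) : Prop :=
  [/\ S \subset B, set0 \in I -> feasible I B
    & forall u, u \notin S -> u \in B -> u |: ~: B \notin I].

Lemma wp_complete s Q : rmem s 2%N 0%N 0%N = #|U|%:R ->
  (forall s', frameI [:: 2%N; 4%N; 5%N] s s' -> frameR [:: 9%N] s s' ->
     rmem s' 9%N 0%N 0%N = #|row s' 2|%:R -> completes (row s 1) (row s' 2) ->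
     Q s') ->
  wp f I complete_cmd s
    ((#|U| * 3).+2 + (1 + ((#|U| * 9).+2 + (#|U| * 3).+2))) Q.
Proof.
move=> s2 post.
apply: wp_seq; apply: (wp_fillI (a := 2) (g := fun=> 0%N)) => //.
  by move=> v s1 _ _ s1v _; apply: wp_setI; rewrite /= s1v.
move=> s1 fr1 rm1 g1; apply: wp_seq; apply: wp_setR.
apply: wp_seq; apply: wp_independent.
- by apply/setP=> u; rewrite !inE g1.
- by rewrite /= upd_same rm1.
move=> s3 A fr3 fr3' s3A s3n SA A0 Amax.
apply: (wp_fillI (a := 2) (g := fun u => u \notin A : nat)) => //.
  (* Truncated subtraction from 1 complements the row whatever its nonzero entries are. *)
  move=> v s4 _ _ s4v s4a; apply: wp_setI; rewrite /= s4v s4a -s3A inE negbK.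
  by case: (imem s3 _ _ _).
move=> s5 fr5 rm5 g5.
have s5A : row s5 2 = ~: A by apply/setP=> u; rewrite !inE g5; case: (u \in A).
apply: post.
- apply: (frameI_trans _ _ fr1 (frameI_trans (Z := [:: 2%N; 4%N; 5%N]) _ _ fr3 fr5)) => //.
- move=> a ha; rewrite rm5 fr3' //= upd_other ?rm1 //.
  by move: ha; rewrite inE.
- by rewrite rm5 s3n s5A.
rewrite s5A /completes /feasible setCK -(row_frame (a := 1) fr1) //; split=> //.
by move=> u us; rewrite inE; apply: Amax.
Qed.

Hypothesis f_nonneg : forall A, 0 <= f A.

(** The two premises allow for an empty family and an empty universe, on which the program must
    still halt. *)
Definition best_ok s : Prop :=
  [/\ rmem s 4%N 0%N 0%N = density f (row s 0),
      set0 \in I -> feasible I (row s 0),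
      density f setT <= density f (row s 0)
    & (0 < #|U|)%N -> row s 0 != set0].

Lemma density_ge0 A : 0 <= density f A.
Proof. by rewrite /density divr_ge0. Qed.

Lemma wp_candidate s Q : rmem s 2%N 0%N 0%N = #|U|%:R -> best_ok s ->
  (forall s' B, frameI [:: 0%N; 2%N; 4%N; 5%N] s s' ->
     frameR [:: 4%N; 8%N; 9%N] s s' -> best_ok s' ->
     density f (row s 0) <= density f (row s' 0) ->
     completes (row s 1) B -> density f B <= density f (row s' 0) -> Q s') ->
  wp f I candidate_cmd s (#|U| * 18 + 20) Q.
Proof.
move=> s2 [s4 sI sT s0] post.
apply: (wp_mono (t := ((#|U| * 3).+2 + (1 + ((#|U| * 9).+2 + (#|U| * 3).+2)) +
  (1 + (1 + (1 + (1 + (#|U| * 3).+2)).+1)))%N) (Q := Q)) => //; last by lia.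
apply: wp_seq; apply: wp_complete => // s1 fr1 fr1' s1n compl.
apply: wp_seq; apply: wp_value; apply: wp_seq; apply: wp_setR => /=.
rewrite upd_same upd_other // s1n -/(row s1 2) -/(density f (row s1 2)).
set s' := State _ _.
have frI : frameI [:: 2%N; 4%N; 5%N] s s' by [].
have frR : frameR [:: 8%N; 9%N] s s'.
  move=> a ha; rewrite /= !upd_other ?fr1' //; move: ha; rewrite !inE negb_or;
    by case/andP.
have r4 : rmem s' 4%N 0%N 0%N = density f (row s 0) by rewrite -s4 -frR.
have row0 : row s' 0 = row s 0 by apply: row_frame frI _.
have r8 : rmem s' 8%N 0%N 0%N = density f (row s1 2) by rewrite /= upd_same.
have guardE : beval #|U| s' (BLeR (rvar 8) (rvar 4)) =
    (density f (row s1 2) <= density f (row s 0)) by rewrite -r4 -r8.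
apply: wp_if; rewrite guardE => guard.
  apply: wp_skip; apply: (post _ (row s1 2)) => //.
  - by apply: frameI_trans frI (frameI_eq (X := [::]) _).
  - by apply: frameR_trans frR (frameR_eq (X := [::]) _).
  - by rewrite /best_ok row0 r4.
  - by rewrite row0.
  - by rewrite row0.
have lt : density f (row s 0) < density f (row s1 2).
by rewrite ltNge.
apply: wp_seq; apply: wp_setR.
apply: (wp_fillI (a := 0) (g := fun u => imem s1 2%N 0%N (enum_rank u))) => //.
  by move=> v s3 fr3 _ s3v _; apply: wp_setI; rewrite /= s3v fr3.
move=> s3 fr3 rm3 g3.
have row3 : row s3 0 = row s1 2 by apply/setP=> u; rewrite !inE g3.
have [h1 h2 h3] := compl.
apply: (post _ (row s1 2)) => //.
- exact: (frameI_trans _ _ frI fr3).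
- apply: (frameR_trans (X := [:: 8%N; 9%N]) (Y := [:: 4%N]) _ _ frR) => //.
  by move=> a; rewrite rm3 inE => ha; apply: upd_other.
- rewrite /best_ok row3; split=> //.
  + by rewrite rm3 /= !upd_same.
  + by apply: le_trans sT (ltW lt).
  (* A strict improvement cannot be empty: the empty set has density 0, as the inverse of 0 is 0. *)
  + move=> _; apply: contraTneq lt => ->.
    by rewrite -leNgt {1}/density cards0 invr0 mulr0 density_ge0.
- by rewrite row3 ltW.
- by rewrite row3.
Qed.

Hypotheses (f_mono : monotone f) (f_super : supermodular f) (f0 : f set0 = 0).
Hypothesis I_matroid : matroid I.

Definition candidate_bound s (b : U -> R) (v : U) : Prop :=
  forall T, feasible I T ->
    f (before b v) <= density f (row s 0) * #|before b v :|: T|%:R.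

Lemma candidate_bound_le s s' b v :
  density f (row s 0) <= density f (row s' 0) ->
  candidate_bound s b v -> candidate_bound s' b v.
Proof.
by move=> le h T feasT; apply: le_trans (h T feasT) _; apply: ler_wpM2r.
Qed.

Lemma wp_vertex s Q : rmem s 2%N 0%N 0%N = #|U|%:R -> best_ok s ->
  (forall s', frameR [:: 1%N; 4%N; 8%N; 9%N] s s' -> best_ok s' ->
     density f (row s 0) <= density f (row s' 0) ->
     (forall v, rmem s' 1%N 0%N (enum_rank v) = greedy f (weights s) v) ->
     (forall v, candidate_bound s' (weights s) v) -> Q s') ->
  wp f I vertex_cmd s (#|U| * (#|U| * 23 + 28)).+2 Q.
Proof.
move=> s2 best post.
pose J (k : nat) s' := [/\ frameR [:: 1%N; 4%N; 8%N; 9%N] s s', best_ok s',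
  density f (row s 0) <= density f (row s' 0),
  (forall v, (enum_rank v < k)%N ->
     rmem s' 1%N 0%N (enum_rank v) = greedy f (weights s) v) &
  (forall v, (enum_rank v < k)%N -> candidate_bound s' (weights s) v)].
apply: (wp_mono (t := (#|U| * ((#|U| * 5).+2 +
  (1 + (1 + (1 + (1 + (#|U| * 18 + 20)))))).+2).+2%N) (Q := Q)) => //; last by lia.
apply: (wp_for (J := J)).
- by move=> k x s' [h1 h2 h3 h4 h5].
- by split=> // v.
- move=> v s1 s1v [h1 h2 h3 h4 h5].
  have eq_w : weights s1 = weights s by rewrite /weights h1.
  apply: wp_seq; apply: (wp_mark s1v) => s3 fr3 rm3 row3; rewrite eq_w in row3.
  have s3v : imem s3 3%N 0%N 0%N = enum_rank v by rewrite fr3.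
  apply: wp_seq; apply: wp_value; apply: wp_seq; apply: wp_setI.
  apply: wp_seq; apply: wp_value; apply: wp_seq; apply: wp_setR.
  rewrite /= s3v -/(row s3 1) row3 coded_set_upd /= -/(row s3 1) row3.
  rewrite (upd_other _ _ _ _ (a := 1) (a' := 3)) // s3v.
  rewrite (upd_other _ _ _ _ (a := 1) (a' := 8)) // !upd_same.
  rewrite -/(before (weights s) v) -/(marginal _ _ _) -/(greedy f _ _).
  set s4 := State _ _.
  have frI4 : frameI [:: 1%N; 4%N] s1 s4.
    move=> a ha; rewrite /= upd_other ?fr3 //; move: ha; rewrite !inE negb_or.
    by case/andP.
  have frR4 : frameR [:: 1%N; 8%N] s1 s4.
    move=> a; rewrite !inE negb_or => /andP[a1 a8]; rewrite /= !upd_other //.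
    by rewrite rm3.
  have row04 : row s4 0 = row s1 0 by apply: row_frame frI4 _.
  have row14 : row s4 1 = before (weights s) v.
    by rewrite /row coded_set_upd /= -/(row s3 1) row3.
  have best4 : best_ok s4.
    have [b1 b2 b3 b4] := h2; rewrite /best_ok row04; split=> //.
    by rewrite -b1 -frR4.
  have s42 : rmem s4 2%N 0%N 0%N = #|U|%:R by rewrite -s2 -h1 // -frR4.
  apply: wp_candidate => // s5 B frI5 frR5 best5; rewrite row04 row14 => le5 compl leB.
  have s51 u : rmem s5 1%N 0%N (enum_rank u) =
      if u == v then greedy f (weights s) v else rmem s1 1%N 0%N (enum_rank u).
    rewrite frR5 //= /upd !eqxx /= (inj_eq val_inj) (inj_eq enum_rank_inj).
    by rewrite rm3; case: eqP.
  split; first by rewrite frI5 // frI4.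
  split=> //.
  + by apply: (frameR_trans _ _ h1 (frameR_trans (Z := [:: 1%N; 4%N; 8%N; 9%N])
      _ _ frR4 frR5)).
  + by apply: le_trans h3 le5.
  + move=> u; rewrite ltnS leq_eqVlt s51 (inj_eq val_inj) (inj_eq enum_rank_inj).
    by case: eqP => [->//|_ /= /h4].
  + move=> u; rewrite ltnS leq_eqVlt (inj_eq val_inj) (inj_eq enum_rank_inj).
    case/orP=> [/eqP->|/h5]; last exact: candidate_bound_le.
    move=> T feasT; have [SB BI Bmax] := compl.
    (* The feasible [T] makes [I] nonempty, so the completion is truly feasible. *)
    have I0 : set0 \in I by apply: I_sub feasT; apply: sub0set.
    have := completion_density f_mono f0 I_matroid (BI I0) _ _ feasT.
    rewrite setCK => /(_ _ SB)/(_ _)/le_trans; apply.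
      by move=> u' uS; rewrite inE negbK; apply: Bmax.
    by apply: ler_wpM2r.
- move=> s' [h1 h2 h3 h4 h5]; apply: post => // v; [exact: h4 | exact: h5].
Qed.

Lemma wp_update s Q :
  (forall s', frameI [:: 3%N] s s' -> frameR [:: 0%N] s s' ->
     (forall v, weights s' v = weights s v + rmem s 5%N 0%N 0%N *
        (rmem s 1%N 0%N (enum_rank v) - weights s v)) -> Q s') ->
  wp f I update_cmd s (#|U| * 3).+2 Q.
Proof.
move=> post; apply: (wp_fillR (a := 0) (g := fun v => weights s v +
   rmem s 5%N 0%N 0%N * (rmem s 1%N 0%N (enum_rank v) - weights s v))) => //.
by move=> v s1 fr1 fr1' s1v s1a; apply: wp_setR; rewrite /= s1v s1a !fr1'.
Qed.

Definition main_inv (k : nat) s : Prop :=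
  [/\ best_ok s, rmem s 2%N 0%N 0%N = #|U|%:R,
     rmem s 5%N 0%N 0%N = step_size R U &
     rmem s 6%N 0%N 0%N = (256 * #|U| ^ 8)%:R] /\
  [/\ rmem s 7%N 0%N 0%N = k%:R, dominating f (weights s) &
      progress f I (row s 0) (weights s) k].

Lemma wp_init Q : (forall s', main_inv 0 s' -> Q s') ->
  wp f I init_cmd (init_state R) (#|U| * 7 + 9) Q.
Proof.
move=> post.
apply: (wp_mono (t := ((#|U| * 4).+2 + (1 + (1 + ((#|U| * 3).+2 +
  (1 + (1 + 1))))))%N) (Q := Q)) => //; last by lia.
apply: wp_seq; apply: (wp_for (J := fun k s => [/\ frameR [:: 2%N] (init_state R) s,
   rmem s 2%N 0%N 0%N = k%:R &
   forall v, (enum_rank v < k)%N -> v \in row s 0])).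
- by move=> k x s [h1 h2 h3]; split.
- by split.
- move=> v s sv [h1 h2 h3]; apply: (wp_seq (t1 := 1) (t2 := 1)); apply: wp_setI; apply: wp_setR.
  rewrite /= sv; split; first by rewrite upd_other.
  split.
  + by move=> a; rewrite inE => ha; rewrite /= upd_other // h1 // inE.
  + by rewrite /= upd_same h2 -natr1.
  + move=> u; rewrite ltnS leq_eqVlt (inj_eq val_inj) (inj_eq enum_rank_inj).
    rewrite /row coded_set_upd /= in_setU1 => /orP[->//|/h3->].
    by rewrite orbT.
- move=> s1 [fr1 s1n row1].
  have {}row1 : row s1 0 = setT by apply/setP=> u; rewrite row1 // inE.
  apply: wp_seq; apply: wp_value; apply: wp_seq; apply: wp_setR.
  rewrite /= upd_same upd_other // s1n -/(row s1 0) row1.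
  apply: wp_seq; apply: (wp_fillR (a := 0) (g := fun=> f setT)) => //.
    by move=> v s fr fr' sv _; apply: wp_setR; rewrite /= sv fr' //= upd_other // upd_same.
  move=> s2 fr2 fr2' w2.
  apply: wp_seq; apply: wp_setR; apply: wp_seq; apply: wp_setR; apply: wp_setR.
  apply: post.
  have s22 : rmem s2 2%N 0%N 0%N = #|U|%:R by rewrite fr2' //= !upd_other.
  have s24 : rmem s2 4%N 0%N 0%N = f setT / #|U|%:R by rewrite fr2' //= upd_same.
  have s27 : rmem s2 7%N 0%N 0%N = 0 by rewrite fr2' //= !upd_other // fr1.
  set s3 := State _ _.
  have row3 : row s3 0 = setT by rewrite -row1; apply: row_frame fr2 _.
  have w3 : weights s3 = fun=> f setT.
    by apply: funext => u; rewrite /weights /= !upd_other // w2.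
  rewrite /main_inv /best_ok row3 w3 /= /upd /= s22 s24 s27.
  split; split=> //.
  + by split=> //; [rewrite /density cardsT | rewrite /feasible setCT |
      rewrite -card_gt0 cardsT].
  + rewrite /step_size; congr _^-1; ring.
  + by rewrite natrM natrX; ring.
  + exact: dominating_const.
  + exact: progress0.
Qed.

Lemma wp_iteration k s : main_inv k s ->
  wp f I (CSeq vertex_cmd (CSeq update_cmd (setr 7 (RAdd (rvar 7) ROne)))) s
    ((#|U| * (#|U| * 23 + 28)).+2 + ((#|U| * 3).+2 + 1)) (main_inv k.+1).
Proof.
case=> -[best s2 s5 s6] [s7 dom prog].
apply: wp_seq; apply: wp_vertex => // s1 fr1 best1 le1 x1 cand1.
apply: wp_seq; apply: wp_update => s3 frI3 frR3 w3; apply: wp_setR.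
set s4 := State _ _.
have row4 : row s4 0 = row s1 0 by apply: row_frame frI3 _.
have w4 : weights s4 = fw_step f (weights s).
  apply: funext => u; rewrite -[LHS]/(weights s3 u) w3 x1.
  by rewrite /fw_step /weights !fr1 // s5.
rewrite /main_inv /best_ok row4 w4 /= /upd /= !frR3 //.
have [h1 h2 h3 h4] := best1; have [g1 g2 g3 g4] := best.
split; split=> //; rewrite ?fr1 //.
- by rewrite s7 natr1.
- exact: dominating_step.
- apply: (progress_step f_mono f_super f0 dom g3 le1) prog => // v T _.
  exact: cand1.
Qed.

(** Initialisation, then [256 n^8] rounds whose constant 6 includes the loop test, and the final
    failing test. *)
Definition time_bound : {poly nat} :=
  'X * 7%N%:P + 9%N%:P + 256%N%:P * 'X^8 *
    ('X * ('X * 23%N%:P + 28%N%:P) + 'X * 3%N%:P + 6%N%:P) + 1%N%:P.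

Lemma time_boundE n : time_bound.[n] =
  (n * 7 + 9 + 256 * n ^ 8 * (n * (n * 23 + 28) + n * 3 + 6) + 1)%N.
Proof. by rewrite /time_bound !(hornerD, hornerM, hornerX, hornerXn, hornerC). Qed.

Lemma densest_cmd_correct : exists (t : nat) (S : {set U}),
  [/\ outputs f I densest_cmd t S, (t <= time_bound.[#|U|])%N
    & (exists2 T : {set U}, T != set0 & feasible I T) ->
      [/\ S != set0, feasible I S
        & forall T : {set U}, T != set0 -> feasible I T ->
            density f S >= 2^-1 * density f T]].
Proof.
pose N := (256 * #|U| ^ 8)%N.
pose tb := ((#|U| * (#|U| * 23 + 28)).+2 + ((#|U| * 3).+2 + 1))%N.
have [t [s [ex le [[best _ _ _] [_ dom prog]]]]] :
    wp f I densest_cmd (init_state R) ((#|U| * 7 + 9) + ((N - 0) * tb.+1).+1)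
      (main_inv N).
  apply: wp_seq; apply: wp_init => s0 inv0.
  apply: (wp_while (J := main_inv) (N := N)) inv0 => //.
    by move=> k s [[_ _ _ s6] [s7 _ _]]; rewrite /= s6 s7 ler_nat ltnNge.
  by move=> k s _; apply: wp_iteration.
exists t, (row s 0); split.
- by exists s.
- apply: leq_trans le _; rewrite time_boundE -/N subn0 /tb -(addn1 (_ * _)).
  by rewrite addnA leq_add2r leq_add2l leq_mul2l; apply/orP; right; lia.
case=> T T0 feasT; have [h1 h2 h3 h4] := best.
have I0 : set0 \in I by apply: I_sub feasT; apply: sub0set.
split; first 1 last.
- exact: h2.
- by apply: progress_end h3 prog => //; rewrite /density divr_ge0.
- by apply: h4; have /set0Pn[u _] := T0; apply/card_gt0P; exists u.
Qed.

End Correctness.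

Theorem theorem1 (R : realType) :
  exists (P : cmd) (p : {poly nat}),
  forall (U : finType) (f : {set U} -> R) (I : {set {set U}}),
    (forall A : {set U}, 0 <= f A) ->
    monotone f -> supermodular f -> f set0 = 0 -> matroid I ->
    exists (t : nat) (S : {set U}),
      [/\ outputs f I P t S,
          (t <= p.[#|U|])%N
        & (exists2 T : {set U}, T != set0 & feasible I T) ->
          [/\ S != set0, feasible I S
            & forall T : {set U}, T != set0 -> feasible I T ->
                density f S >= 2^-1 * density f T]].
Proof.
exists densest_cmd, time_bound => U f I f_nonneg f_mono f_super f0 I_matroid.
by apply: densest_cmd_correct => //; case: I_matroid.
Qed.
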